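(* Assume that $\lambda_{m-1}<\lambda_m$ if $m>1$, that $\lambda_M<\lambda_{M+1}$, and that $\|\gamma_hv\|\ne0$ for all $v\in\mathrm{Span}\{\varphi_m^0,\dots,\varphi_M^0\}\setminus\{0\}$. Set $$\bar c_h:=\max\Big\{\Big(\frac{\lambda_{Mh}}{\lambda_1}-1\Big)^2,1\Big\}.$$ Then, writing $\|\cdot\|_{\mathfrak S_2}$ for $\|\cdot\|_{\mathfrak S_2(\mathcal H)}$, $$\begin{aligned}\|\mathrm{Res}(\gamma_h)\|_{\mathfrak S_2}^2\le{}&\bar c_h\|A^{1/2}(\gamma^0-\gamma_h)\|_{\mathfrak S_2}^2+\frac{3(\lambda_M-\lambda_m)^2}{4\lambda_m}\|\gamma^0-\gamma_h\|_{\mathfrak S_2}^4+\frac3{\lambda_m}\Big(1+\frac14\|\gamma^0-\gamma_h\|_{\mathfrak S_2}^4\Big)\\&\times\Big[2\Big(1+\frac{\lambda_M}{4\lambda_m}\|\gamma^0-\gamma_h\|_{\mathfrak S_2}^2\Big)^2\|A^{1/2}(\gamma^0-\gamma_h)\|_{\mathfrak S_2}^4+2\lambda_M^2\|\gamma^0-\gamma_h\|_{\mathfrak S_2}^4\Big].\end{aligned}$$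
   Context: $\mathcal H$ is a real separable Hilbert space with inner product $(\cdot,\cdot)$ and norm $\|\cdot\|$; $\|B\|_{\mathfrak S_2(\mathcal H)}$ is the Hilbert–Schmidt norm. $A$ is a self-adjoint, positive definite operator on $\mathcal H$ with domain $D(A)$ and compact resolvent; $(\lambda_k)_{k\ge1}$ is the nondecreasing sequence of its (positive) eigenvalues counted with multiplicity, $\lambda_k\to+\infty$, and $(\varphi_k^0)_{k\ge1}$ is an orthonormal basis of $\mathcal H$ with $A\varphi_k^0=\lambda_k\varphi_k^0$. For $s\in\mathbb{R}$, $D(A^s):=\{v\in\mathcal H:\sum_k\lambda_k^{2s}|(v,\varphi_k^0)|^2<\infty\}$ and $A^sv:=\sum_k\lambda_k^s(v,\varphi_k^0)\varphi_k^0$. Let $1\le m\le M$ be integers. $V_h\subset D(A^{1/2})$ is a finite-dimensional subspace with $\dim V_h\ge M$. The approximate eigenpairs $(\varphi_{kh},\lambda_{kh})\in V_h\times\mathbb{R}_+$, $1\le k\le\dim V_h$, satisfy $(\varphi_{kh},\varphi_{jh})=\delta_{kj}$, $(A^{1/2}\varphi_{kh},A^{1/2}v_h)=\lambda_{kh}(\varphi_{kh},v_h)$ for all $v_h\in V_h$, and $0<\lambda_{1h}\le\lambda_{2h}\le\cdots$ (counting multiplicities). The density matrices are $\gamma^0v:=\sum_{i=m}^M(v,\varphi_i^0)\varphi_i^0$ and $\gamma_hv:=\sum_{i=m}^M(v,\varphi_{ih})\varphi_{ih}$ for $v\in\mathcal H$. The cluster residual is the bounded operator $\mathrm{Res}(\gamma_h):=A^{1/2}\gamma_h-A^{-1/2}(A^{1/2}\gamma_h)^\dagger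 A^{1/2}\gamma_h$ on $\mathcal H$, where $B^\dagger$ denotes the adjoint of a bounded operator $B$. *)

(* Defs.v *)
From mathcomp Require Import all_boot all_order all_algebra.
From mathcomp Require Import all_classical all_reals all_analysis.

Set Implicit Arguments.
Unset Strict Implicit.
Unset Printing Implicit Defensive.

Import Order.TTheory GRing.Theory Num.Theory.
Import numFieldNormedType.Exports.

Local Open Scope classical_set_scope.
Local Open Scope ring_scope.

(* A partially defined linear operator on H. The values of [opfun] outside the
   domain [opdom] are irrelevant. *)
Record unbounded_op (R : realType) (H : lmodType R) := UnboundedOp {
  opdom : set H;
  opfun :> H -> H;
  opdom0 : opdom 0;
  op_linear : forall (a : R) (u v : H), opdom u -> opdom v ->
    opdom (a *: u + v) /\ opfun (a *: u + v) = a *: opfun u + opfun v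
}.

(* All sequences are indexed from 1; their value at
   index 0 is never used. *)
Section Hilbert.
Variables (R : realType) (H : completeNormedModType R).
Variable dot : {dot H for idfun}.
Implicit Types (A : unbounded_op H) (e phi : nat -> H) (lam : nat -> R).

(* The norm of the Banach space H comes from the (real) inner product, and H is
   separable. *)
Definition separable_hilbert : Prop :=
  (forall x : H, dot x x = `|x| ^+ 2) /\
  exists2 D : set H, countable D & dense D.

Definition orthonormal_upto (N : nat) e : Prop :=
  forall j k, (1 <= j <= N)%N -> (1 <= k <= N)%N ->
    dot (e j) (e k) = (j == k)%:R.

Definition orthonormal_basis e : Prop :=
  (forall N, orthonormal_upto N e) /\
  forall v : H, \sum_(1 <= k < n) dot v (e k) *: e k @[n --> \oo] --> v.

(* The first clause makes the adjoint single-valued; the second says that the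
   graph of the adjoint is the graph of A. *)
Definition self_adjoint A : Prop :=
  dense (opdom A) /\
  forall u w : H,
    (forall v, opdom A v -> dot (A v) u = dot v w) <-> (opdom A u /\ A u = w).

Definition positive_definite A : Prop :=
  forall v : H, opdom A v -> v != 0 -> 0 < dot (A v) v.

Definition compact_operator (T : {linear H -> H}) : Prop :=
  forall B : set H, bounded_set B -> precompact (T @` B).

(* (A - mu)^-1 exists as an operator on H and is compact, for some mu. *)
Definition compact_resolvent A : Prop :=
  exists (mu : R) (T : {linear H -> H}),
    [/\ forall u, opdom A (T u) /\ A (T u) - mu *: T u = u,
        forall v, opdom A v -> T (A v - mu *: v) = v
      & compact_operator T].

(* The (lam k, phi k), k >= 1, are the eigenpairs of A. Since the phi k form an
   orthonormal basis, every eigenvalue occurs in lam, with its multiplicity. *)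
Record eigensystem A lam phi : Prop := Eigensystem {
  eigen_basis : orthonormal_basis phi;
  eigen_eq : forall k, (1 <= k)%N ->
    opdom A (phi k) /\ A (phi k) = lam k *: phi k;
  eigen_gt0 : forall k, (1 <= k)%N -> 0 < lam k;
  eigen_le : forall j k, (1 <= j <= k)%N -> lam j <= lam k;
  eigen_cvg : lam @ \oo --> +oo
}.

Definition pow_dom lam phi (s : R) : set H :=
  [set v | (\sum_(1 <= k <oo) (lam k `^ (2 * s) * `|dot v (phi k)| ^+ 2)%:E
            < +oo)%E].

(* A^s v; meaningful for v in [pow_dom lam phi s]. *)
Definition pow_op lam phi (s : R) (v : H) : H :=
  lim (\sum_(1 <= k < n) (lam k `^ s * dot v (phi k)) *: phi k @[n --> \oo]).

Definition lin_span (i j : nat) (f : nat -> H) : set H :=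
  [set v | exists c : nat -> R, v = \sum_(i <= k < j.+1) c k *: f k].

(* V is a linear subspace of H of (finite) dimension N. *)
Definition subspace_of_dim (V : set H) (N : nat) : Prop :=
  exists f : nat -> H,
    (forall c : nat -> R, \sum_(1 <= k < N.+1) c k *: f k = 0 ->
       forall k, (1 <= k <= N)%N -> c k = 0) /\
    V = lin_span 1 N f.

(* The (lamh k, phih k), 1 <= k <= N, are the Galerkin eigenpairs on the
   N-dimensional space V. *)
Record approx_eigensystem lam phi (V : set H) (N : nat)
    (lamh : nat -> R) (phih : nat -> H) : Prop := ApproxEigensystem {
  approx_in : forall k, (1 <= k <= N)%N -> V (phih k);
  approx_orthonormal : orthonormal_upto N phih;
  approx_eq : forall k, (1 <= k <= N)%N -> forall v, V v ->
    dot (pow_op lam phi 2^-1 (phih k)) (pow_op lam phi 2^-1 v) =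
    lamh k * dot (phih k) v;
  approx_gt0 : forall k, (1 <= k <= N)%N -> 0 < lamh k;
  approx_le : forall j k, (1 <= j)%N -> (j <= k <= N)%N -> lamh j <= lamh k
}.

Definition density_matrix (m M : nat) (f : nat -> H) (v : H) : H :=
  \sum_(m <= i < M.+1) dot v (f i) *: f i.

(* The adjoint B^dagger of an everywhere defined operator. For B linear and
   bounded, the w below exists (Riesz) and is unique. *)
Definition adjoint (B : H -> H) (u : H) : H :=
  xget 0 [set w | forall v, dot (B v) u = dot v w].

Definition residual lam phi (g : H -> H) : H -> H :=
  let B := pow_op lam phi 2^-1 \o g in
  B \- (pow_op lam phi (- 2^-1) \o adjoint B \o B).

(* The Hilbert-Schmidt norm, with values in [0, +oo], computed in the
   orthonormal basis e; it does not depend on e when B is linear and bounded. *)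
Definition hs_norm e (B : H -> H) : \bar R :=
  sqrte (\sum_(1 <= k <oo) (`|B (e k)| ^+ 2)%:E)%E.

End Hilbert.

(* Main.v *)
Require Import Defs.
From mathcomp Require Import all_boot all_order all_algebra.
From mathcomp Require Import all_classical all_reals all_analysis.
From mathcomp Require Import ring lra.

Set Implicit Arguments.
Unset Strict Implicit.
Unset Printing Implicit Defensive.

Import Order.TTheory GRing.Theory Num.Theory.
Import numFieldNormedType.Exports.

Local Open Scope classical_set_scope.
Local Open Scope ring_scope.

(* With q_i the discrete eigenvectors (m <= i <= M) and nu_i their eigenvalues,
   Res(gamma_h) v is the sum of the (v, q_i) r_i, where
   r_i = A^(1/2) q_i - nu_i A^(-1/2) q_i has the coordinate
   (lam_k - nu_i) lam_k^(-1/2) (q_i, phi_k) along phi_k, so that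
   |Res|^2 = sum_i |r_i|^2. Let T and D be the traces of the two Gram matrices
   Omega of the components of the A^(1/2) q_i outside the cluster
   Span(phi_m, ..., phi_M) and Delta of the components of the phi_k,
   m <= k <= M, outside Span(q_m, ..., q_M).
   The coordinates outside the cluster contribute at most c_h T, by a termwise
   comparison. Inside, the Galerkin equations write (nu_i - lam_k) (q_i, phi_k)
   as an entry of Omega G - G Lam Delta, G being the contraction
   ((q_i, phi_k)) and Lam = diag(lam_k); as the Frobenius norm of a positive
   semidefinite matrix is at most its trace, this contributes at most
   (2 / lam_m) (T^2 + lam_M^2 D^2). Finally |gamma0 - gamma_h|^2 = 2 D and
   |A^(1/2) (gamma0 - gamma_h)|^2 = T + tr (Lam Delta) >= T. *)

(** * Finite orthonormal families and Gram matrices *)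

Section InnerProduct.
Context (R : realType) (H : lmodType R) (dot : {dot H for idfun}).

Lemma dotC u v : dot u v = dot v u.
Proof. by rewrite hermC expr0 mul1r. Qed.

Lemma dotZl a u v : dot (a *: u) v = a * dot u v.
Proof. exact: linearZl_LR. Qed.

Lemma dotZr a u v : dot u (a *: v) = a * dot u v.
Proof. exact: linearZr_LR. Qed.

Lemma dotDl u v w : dot (u + v) w = dot u w + dot v w.
Proof. exact: linearDl. Qed.

Lemma dotDr u v w : dot w (u + v) = dot w u + dot w v.
Proof. exact: linearDr. Qed.

Lemma dotBl u v w : dot (u - v) w = dot u w - dot v w.
Proof. exact: linearBl. Qed.

Lemma dotBr u v w : dot w (u - v) = dot w u - dot w v.
Proof. exact: linearBr. Qed.

Lemma dot_suml I (r : seq I) (P : pred I) (f : I -> H) v :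
  dot (\sum_(i <- r | P i) f i) v = \sum_(i <- r | P i) dot (f i) v.
Proof. exact: linear_sumlz. Qed.

Lemma dot_sumr I (r : seq I) (P : pred I) (f : I -> H) u :
  dot u (\sum_(i <- r | P i) f i) = \sum_(i <- r | P i) dot u (f i).
Proof. exact: linear_sumr. Qed.

Lemma dot_ge0 u : 0 <= dot u u.
Proof.
have [->|u0] := eqVneq u 0; first by rewrite linear0l.
exact/ltW/neq0_dnorm_gt0.
Qed.

(** The square norm of (v, v) u - (u, v) v is (v, v) times the difference of the two sides. *)
Lemma dot_cauchy_schwarz u v : dot u v ^+ 2 <= dot u u * dot v v.
Proof.
have [->|v0] := eqVneq v 0; first by rewrite linear0r expr2 mul0r mulr_ge0 ?dot_ge0.
have vv : 0 < dot v v by exact: neq0_dnorm_gt0.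
rewrite -subr_ge0 -(pmulr_rge0 _ vv).
have := dot_ge0 (dot v v *: u - dot u v *: v).
rewrite dotBl !dotBr !dotZl !dotZr (dotC v u).
by congr (_ <= _); ring.
Qed.

Lemma dot_eq0P w : (forall v, dot v w = 0) -> w = 0.
Proof.
move=> w0; apply/eqP; apply: contraT => /neq0_dnorm_gt0 w_gt0.
by have := w_gt0 _ dot; rewrite w0 ltxx.
Qed.

Lemma dot_delta_sum (I : finType) (f : I -> R) i :
  \sum_j (i == j)%:R * f j = f i.
Proof.
rewrite (bigD1 i)//= eqxx mul1r big1 ?addr0// => j.
by rewrite eq_sym => /negPf ->; rewrite mul0r.
Qed.

Section OrthonormalFamily.
Context (I : finType) (p : I -> H).
Hypothesis p_on : forall i j, dot (p i) (p j) = (i == j)%:R.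

Definition proj_onto u := \sum_i dot u (p i) *: p i.

Lemma dot_proj u j : dot (proj_onto u) (p j) = dot u (p j).
Proof.
rewrite dot_suml -(dot_delta_sum (fun i => dot u (p i)) j).
by apply: eq_bigr => i _; rewrite dotZl p_on eq_sym mulrC.
Qed.

(** The projection is orthogonal to the remainders, so only one correction term survives. The
    entries of both Omega and Delta have this form. *)
Lemma dot_sub_proj u v : dot (u - proj_onto u) (v - proj_onto v) =
  dot u v - \sum_i dot u (p i) * dot v (p i).
Proof.
have dv w : dot w (proj_onto v) = \sum_i dot w (p i) * dot v (p i).
  rewrite dot_sumr; apply: eq_bigr => i _.
  by rewrite dotZr mulrC.
have -> : dot (u - proj_onto u) (v - proj_onto v) = dot (u - proj_onto u) v.
  rewrite dotBr dv big1 ?subr0// => i _.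
  by rewrite dotBl dot_proj subrr mul0r.
rewrite dotBl; congr (_ - _); rewrite dotC dot_sumr.
by apply: eq_bigr => i _; rewrite dotZr.
Qed.

Lemma bessel u : \sum_i dot u (p i) ^+ 2 <= dot u u.
Proof.
rewrite -subr_ge0 (eq_bigr (fun i => dot u (p i) * dot u (p i))) => [|i _].
  by rewrite -dot_sub_proj dot_ge0.
by rewrite expr2.
Qed.

Lemma dot_lincomb (x : I -> R) :
  dot (\sum_i x i *: p i) (\sum_i x i *: p i) = \sum_i x i ^+ 2.
Proof.
rewrite dot_suml; apply: eq_bigr => i _.
rewrite dotZl dot_sumr expr2; congr (_ * _).
rewrite -[RHS](dot_delta_sum x); apply: eq_bigr => j _.
by rewrite dotZr p_on mulrC.
Qed.

End OrthonormalFamily.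

(** This is the contraction property of G: Bessel's inequality for [p], applied to the vector with
    coefficients [x] in the family [q]. *)
Lemma bessel_lincomb (I J : finType) (p : I -> H) (q : J -> H) (x : J -> R) :
  (forall i j, dot (p i) (p j) = (i == j)%:R) ->
  (forall i j, dot (q i) (q j) = (i == j)%:R) ->
  \sum_k (\sum_j x j * dot (q j) (p k)) ^+ 2 <= \sum_j x j ^+ 2.
Proof.
move=> p_on q_on; rewrite -(dot_lincomb q_on).
apply: le_trans (bessel p_on _); apply: ler_sum => k _.
rewrite dot_suml; under [X in _ <= X ^+ 2]eq_bigr do rewrite dotZl.
exact: lexx.
Qed.

(** Cauchy-Schwarz on each entry bounds the Frobenius norm of a Gram matrix by its trace. *)
Lemma gram_sqr_le (I : finType) (w : I -> H) :
  \sum_i \sum_j dot (w i) (w j) ^+ 2 <= (\sum_i dot (w i) (w i)) ^+ 2.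
Proof.
rewrite expr2 mulr_suml; apply: ler_sum => i _.
rewrite mulr_sumr; apply: ler_sum => j _; exact: dot_cauchy_schwarz.
Qed.

(* [q' i] stands for A^(1/2) (q i). *)
Lemma cluster_bound (I : finType) (p q q' : I -> H) (mu nu : I -> R) (mn mx : R) :
  (forall i j, dot (p i) (p j) = (i == j)%:R) ->
  (forall i j, dot (q i) (q j) = (i == j)%:R) ->
  (forall i j, dot (q' i) (q' j) = nu i * (i == j)%:R) ->
  (forall i k, dot (q' i) (p k) = Num.sqrt (mu k) * dot (q i) (p k)) ->
  0 < mn -> (forall k, mn <= mu k <= mx) ->
  \sum_i \sum_k (mu k - nu i) ^+ 2 / mu k * dot (q i) (p k) ^+ 2 <=
  2 / mn * ((\sum_i (nu i - \sum_k mu k * dot (q i) (p k) ^+ 2)) ^+ 2 +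
            mx ^+ 2 * (\sum_k (1 - \sum_i dot (q i) (p k) ^+ 2)) ^+ 2).
Proof.
move=> p_on q_on q'_on q'p mn0 mu_bd.
have mu0 k : 0 < mu k by have /andP[+ _] := mu_bd k; exact: lt_le_trans.
(* [g] is the matrix G; Omega and Delta are the Gram matrices of [w] and [d]. *)
pose g i k := dot (q i) (p k).
pose w i := q' i - proj_onto p (q' i); pose d k := p k - proj_onto q (p k).
have wE i j : dot (w i) (w j) = nu i * (i == j)%:R - \sum_k mu k * (g i k * g j k).
  rewrite dot_sub_proj// q'_on; congr (_ - _); apply: eq_bigr => k _.
  by rewrite !q'p mulrACA -expr2 sqr_sqrtr// ltW.
have dE k l : dot (d k) (d l) = (k == l)%:R - \sum_i g i k * g i l.
  rewrite dot_sub_proj// p_on; congr (_ - _); apply: eq_bigr => i _.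
  by rewrite ![dot (p _) _]dotC.
(* With N = diag(nu), Omega = N - G Lam G^T and Delta = 1 - G^T G. Hence G Lam Delta and Omega G
   both contain [X], an entry of G Lam G^T G, which cancels and leaves G Lam - N G. *)
have keyE i k : (mu k - nu i) * g i k =
  (\sum_l (mu l * dot (d l) (d k)) * g i l) - \sum_j dot (w i) (w j) * g j k.
  pose X := \sum_l \sum_j mu l * g i l * g j l * g j k.
  have -> : \sum_l (mu l * dot (d l) (d k)) * g i l = mu k * g i k - X.
    rewrite -(dot_delta_sum (fun l => mu l * g i l) k) -sumrB.
    apply: eq_bigr => l _; rewrite dE mulrBr mulrBl (eq_sym k); congr (_ - _).
      by ring.
    by rewrite mulr_sumr mulr_suml; apply: eq_bigr => j _; ring.
  have -> : \sum_j dot (w i) (w j) * g j k = nu i * g i k - X.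
    rewrite -(dot_delta_sum (fun j => nu i * g j k) i) /X exchange_big -sumrB.
    apply: eq_bigr => j _; rewrite wE mulrBl; congr (_ - _); first by ring.
    by rewrite mulr_suml; apply: eq_bigr => l _; ring.
  by ring.
(* The contraction G acts on each row of Omega. *)
have T2 : \sum_i \sum_k (\sum_j dot (w i) (w j) * g j k) ^+ 2 <=
          (\sum_i dot (w i) (w i)) ^+ 2.
  apply: le_trans (gram_sqr_le w); apply: ler_sum => i _.
  exact: bessel_lincomb.
(* Here G acts on the columns of Lam Delta, so [p] and [q] exchange roles; the factor Lam costs
   [mx ^+ 2]. *)
have D2 : \sum_i \sum_k (\sum_l (mu l * dot (d l) (d k)) * g i l) ^+ 2 <=
          mx ^+ 2 * (\sum_k dot (d k) (d k)) ^+ 2.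
  apply: le_trans (ler_wpM2l (sqr_ge0 mx) (gram_sqr_le d)).
  rewrite exchange_big mulr_sumr; apply: ler_sum => k _.
  rewrite (eq_bigr (fun i =>
    (\sum_l (mu l * dot (d l) (d k)) * dot (p l) (q i)) ^+ 2)) => [|i _]; last first.
    by congr (_ ^+ 2); apply: eq_bigr => l _; rewrite (dotC (p l)).
  apply: le_trans (bessel_lincomb _ q_on p_on) _.
  rewrite mulr_sumr; apply: ler_sum => l _.
  rewrite exprMn (dotC (d l)); apply: ler_wpM2r; first exact: sqr_ge0.
  have /andP[_ le_mx] := mu_bd l.
  by rewrite ler_sqr// nnegrE; have := mu0 l; lra.
have -> : \sum_i (nu i - \sum_k mu k * dot (q i) (p k) ^+ 2) =
          \sum_i dot (w i) (w i).
  by apply: eq_bigr => i _; rewrite wE eqxx mulr1.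
have -> : \sum_k (1 - \sum_i dot (q i) (p k) ^+ 2) = \sum_k dot (d k) (d k).
  by apply: eq_bigr => i _; rewrite dE eqxx.
apply: (@le_trans _ _ (2 / mn *
  (\sum_i \sum_k (\sum_j dot (w i) (w j) * g j k) ^+ 2 +
   \sum_i \sum_k (\sum_l (mu l * dot (d l) (d k)) * g i l) ^+ 2))).
  rewrite -big_split mulr_sumr; apply: ler_sum => i _ /=.
  rewrite -big_split mulr_sumr; apply: ler_sum => k _ /=.
  set a := \sum_j _; set b := \sum_l _.
  rewrite -/(g i k) mulrAC -exprMn keyE -/a -/b.
  have /andP[le_mn _] := mu_bd k.
  (* First 1 / [mu k] is at most 1 / [mn]; then (b - a)^2 <= 2 (a^2 + b^2) produces the factor 2. *)
  apply: (@le_trans _ _ ((b - a) ^+ 2 / mn)).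
    by rewrite ler_wpM2l ?sqr_ge0// lef_pV2 ?posrE.
  rewrite [leRHS]mulrAC; apply: ler_wpM2r; first by rewrite invr_ge0 ltW.
  by have := sqr_ge0 (a + b); nra.
apply: ler_wpM2l; first by rewrite divr_ge0// ltW.
exact: lerD.
Qed.

End InnerProduct.

Lemma nondecreasing_sum (R : numDomainType) (u : nat -> R) :
  (forall k, 0 <= u k) ->
  {homo (fun n => \sum_(1 <= k < n) u k) : m n / (m <= n)%N >-> m <= n}.
Proof.
move=> u0; apply: homo_leq => [//|y x z|[|n]]; first exact: le_trans.
  by rewrite !big_geq.
by rewrite [leRHS]big_nat_recr//= lerDl.
Qed.

(** * Orthonormal bases: Parseval and Riesz-Fischer *)

Section HilbertBasis.
Context (R : realType) (H : completeNormedModType R) (dot : {dot H for idfun}).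
Hypothesis dot_norm : forall x : H, dot x x = `|x| ^+ 2.

(** Polarization reduces the continuity of the inner product to that of the norm. *)
Lemma dot_cvgr u (f : nat -> H) l :
  f @ \oo --> l -> dot u (f n) @[n --> \oo] --> dot u l.
Proof.
move=> fl.
have polar v : dot u v = (`|u + v| * `|u + v| - `|u - v| * `|u - v|) / 4.
  rewrite -!expr2 -!dot_norm dotBl !dotBr dotDl !dotDr (dotC dot v u).
  by field.
under eq_fun do rewrite polar.
rewrite polar; apply: cvgMl.
have norm_cvg (g : nat -> H) w : g @ \oo --> w ->
    `|g n| * `|g n| @[n --> \oo] --> `|w| * `|w|.
  by move=> gw; apply: cvgM; exact: cvg_norm.
by apply: cvgB; apply: norm_cvg; [apply: cvgD|apply: cvgB] => //; exact: cvg_cst.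
Qed.

Lemma orthonormal_eq e : (forall N, orthonormal_upto dot N e) ->
  forall j k, (0 < j)%N -> (0 < k)%N -> dot (e j) (e k) = (j == k)%:R.
Proof.
by move=> e_on j k j0 k0; apply: (e_on (maxn j k)); rewrite ?j0 ?k0 ?leq_maxl ?leq_maxr.
Qed.

Lemma parseval e : orthonormal_basis dot e -> forall u v,
  \sum_(1 <= k < n) dot u (e k) * dot v (e k) @[n --> \oo] --> dot u v.
Proof.
move=> [_ he] u v; have /(dot_cvgr (u := u)) := he v.
apply: cvg_trans; apply: near_eq_cvg.
near=> n; rewrite dot_sumr; apply: eq_bigr => k _; rewrite dotZr mulrC//.
Unshelve. all: by end_near.
Qed.

Lemma bessel_seq e v n : orthonormal_basis dot e ->
  \sum_(1 <= k < n) dot v (e k) ^+ 2 <= dot v v.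
Proof.
move=> he; have cv := @parseval _ he v v.
rewrite -(cvg_lim (@Rhausdorff R) cv).
apply: le_trans (nondecreasing_cvgn_le _ _ n).
- by apply: ler_sum => k _; rewrite expr2.
- by apply: nondecreasing_sum => k; rewrite -expr2 sqr_ge0.
- by apply/cvg_ex; eexists; exact: cv.
Qed.

Lemma basis_inj e u v : orthonormal_basis dot e ->
  (forall k, (0 < k)%N -> dot u (e k) = dot v (e k)) -> u = v.
Proof.
move=> [_ he] uv; apply: (@cvg_unique _ (@norm_hausdorff _ H) _ _ _ _ (he u)).
have := he v; apply: cvg_trans; apply: near_eq_cvg; near=> n.
by apply: eq_big_nat => k /andP[k0 _]; rewrite uv.
Unshelve. all: by end_near.
Qed.

Lemma parseval_le e u v c : orthonormal_basis dot e ->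
  (forall k, (0 < k)%N -> dot u (e k) ^+ 2 <= c * dot v (e k) ^+ 2) ->
  dot u u <= c * dot v v.
Proof.
move=> he uv; apply: (ler_cvg_to (@parseval _ he u u)).
  apply: cvgMr; exact: (@parseval _ he v v).
near=> n; rewrite mulr_sumr; apply: ler_sum_nat => k /andP[k0 _].
by rewrite -!expr2 uv.
Unshelve. all: by end_near.
Qed.

(** Orthogonality turns |S m - S n|^2 into q m - q n. The real sums [q] are monotone and bounded,
    hence Cauchy; so [S] is Cauchy in the complete space H. *)
Lemma riesz_fischer e (c : nat -> R) (b : R) : orthonormal_basis dot e ->
  (forall n, \sum_(1 <= k < n) c k ^+ 2 <= b) ->
  cvgn (fun n => \sum_(1 <= k < n) c k *: e k).
Proof.
move=> [he _] cb.
have e_on := orthonormal_eq he.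
pose S n := \sum_(1 <= k < n) c k *: e k.
pose q n := \sum_(1 <= k < n) c k ^+ 2.
have q_nd : {homo q : m n / (m <= n)%N >-> m <= n}.
  by apply: nondecreasing_sum => k; exact: sqr_ge0.
have Sq n m : (n <= m)%N -> `|S m - S n| ^+ 2 = q m - q n.
  move=> nm.
  suff ortho a b' : (a <= b')%N ->
      dot (S b') (S a) = q a.
    by rewrite -dot_norm dotBl !dotBr (dotC dot (S n) (S m)) !ortho//; ring.
  move=> ab; rewrite /S dot_sumr; apply: eq_big_nat => k /andP[k0 ka].
  rewrite dotZr dot_suml expr2; congr (_ * _).
  rewrite (bigD1_seq k) ?iota_uniq//=; last by rewrite mem_index_iota k0 (leq_trans ka).
  rewrite dotZl e_on// eqxx mulr1 big_nat_cond big1 ?addr0// => j.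
  by move=> /andP[/andP[j0 _] /negPf jk]; rewrite dotZl e_on// jk mulr0.
have /cauchy_cvgP/cauchy_ballP qC : cvgn q.
  apply: nondecreasing_is_cvgn => //.
  by exists b => _ [n _ <-]; exact: cb.
apply/cauchy_cvgP; apply/cauchy_ballP => eps eps0; near_simpl.
have := qC (eps ^+ 2) (exprn_gt0 2 eps0); near_simpl.
apply: filterS => -[m n] /=.
rewrite -!ball_normE /= -/(S m) -/(S n) => qe.
rewrite -(ltr_pXn2r (n := 2)) ?nnegrE//; last exact: ltW.
have [/Sq|/ltnW/Sq] := leqP n m; first by move->; exact: le_lt_trans (ler_norm _) qe.
by rewrite distrC => ->; apply: le_lt_trans (ler_norm _) _; rewrite distrC.
Qed.

(** * Powers of A in eigenvector coordinates *)

Section Powers.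
Context (lam : nat -> R) (phi : nat -> H).
Hypothesis phi_basis : orthonormal_basis dot phi.

(** The series defining the power is the expansion of the given vector [y], which supplies its
    convergence. *)
Lemma pow_op_eq s v y :
  (forall k, (0 < k)%N -> dot y (phi k) = lam k `^ s * dot v (phi k)) ->
  pow_op dot lam phi s v = y.
Proof.
move=> yE; apply: cvg_lim; first exact: norm_hausdorff.
have [_ /(_ y)] := phi_basis; apply: cvg_trans; apply: near_eq_cvg; near=> n.
by apply: eq_big_nat => k /andP[k0 _]; rewrite yE.
Unshelve. all: by end_near.
Qed.

(** Membership in the domain is the square-summability that Riesz-Fischer asks for; the coordinate
    is then read off by continuity of the inner product. *)
Lemma coord_pow_op s v k : pow_dom dot lam phi s v -> (0 < k)%N ->
  dot (pow_op dot lam phi s v) (phi k) = lam k `^ s * dot v (phi k).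
Proof.
move=> dv k0; pose c k := lam k `^ s * dot v (phi k).
pose t := (\sum_(1 <= k <oo) (lam k `^ (2 * s) * `|dot v (phi k)| ^+ 2)%:E)%E.
have t_ge0 n : (0 <= (lam n `^ (2 * s) * `|dot v (phi n)| ^+ 2)%:E)%E.
  by rewrite lee_fin mulr_ge0 ?powR_ge0 ?sqr_ge0.
have tfin : t \is a fin_num.
  by rewrite ge0_fin_numE//; apply: nneseries_ge0.
have cb n : \sum_(1 <= k < n) c k ^+ 2 <= fine t.
  rewrite -lee_fin fineK//.
  have := @nneseries_lim_ge R (fun k => (lam k `^ (2 * s) * `|dot v (phi k)| ^+ 2)%:E)
    xpredT 1 n (fun n _ _ => t_ge0 n).
  rewrite sumEFin; congr (_ <= _)%E; congr EFin; apply: eq_bigr => j _.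
  rewrite /c exprMn real_normK ?num_real//; congr (_ * _).
  by rewrite (mulrC 2) powRrM -powR_mulrn ?powR_ge0.
have := dot_cvgr (u := phi k) (riesz_fischer phi_basis cb).
rewrite dotC => cv; rewrite -(cvg_lim (@Rhausdorff R) cv) -/(c k).
(* As soon as n > k, the partial sum has [c k] as its coordinate along [phi k]. *)
apply: lim_near_cst => //; near=> n.
rewrite dot_sumr (bigD1_seq k) ?iota_uniq//=; last first.
  by rewrite mem_index_iota k0; near: n; exists k.+1.
have e_on := orthonormal_eq phi_basis.1.
rewrite dotZr e_on// eqxx mulr1 big_nat_cond big1 ?addr0// => j.
by move=> /andP[/andP[j0 _] /negPf jk]; rewrite dotZr e_on// eq_sym jk mulr0.
Unshelve. all: by end_near.
Qed.

End Powers.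

(** * Adjoints and Hilbert-Schmidt norms of finite-rank operators *)

Lemma adjoint_eq (B : H -> H) u w :
  (forall v, dot (B v) u = dot v w) -> adjoint dot B u = w.
Proof.
move=> Bw; rewrite /adjoint; case: xgetP => [y _ By|/(_ w)/(_ Bw)//].
apply/eqP; rewrite -subr_eq0; apply/eqP/(@dot_eq0P _ _ dot) => v.
by rewrite dotBr -By Bw subrr.
Qed.

(** Expanding |B e_k|^2 leaves the sums over k of (x_i, e_k) (x_j, e_k), which Parseval evaluates;
    the basis [e] disappears from the result. *)
Lemma hs_norm_sqr (I : finType) (x y : I -> H) (e : nat -> H) (B : H -> H) :
  orthonormal_basis dot e -> (forall v, B v = \sum_i dot v (x i) *: y i) ->
  (hs_norm e B ^+ 2)%E =
  (\sum_i \sum_j dot (x i) (x j) * dot (y i) (y j))%:E.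
Proof.
move=> he BE; rewrite /hs_norm sqr_sqrte; last first.
  by apply: nneseries_ge0 => n _ _; rewrite lee_fin sqr_ge0.
apply: cvg_lim; first exact: ereal_hausdorff.
under eq_fun do rewrite sumEFin; apply: cvg_EFin; first by near=> n.
rewrite /comp /=.
have -> : (fun n => \sum_(1 <= k < n) `|B (e k)| ^+ 2) =
  (fun n => \sum_i \sum_j (\sum_(1 <= k < n) dot (x i) (e k) * dot (x j) (e k))
                          * dot (y i) (y j)).
  apply/funext => n; under [RHS]eq_bigr do
    (under eq_bigr do rewrite mulr_suml; rewrite exchange_big).
  rewrite exchange_big; apply: eq_bigr => k _ /=.
  rewrite -dot_norm BE dot_suml; apply: eq_bigr => i _.
  rewrite dotZl dot_sumr mulr_sumr; apply: eq_bigr => j _.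
  by rewrite dotZr !(dotC dot (e k)) mulrA.
apply: cvg_big => [|i _]; first exact: add_continuous.
apply: cvg_big => [|j _]; first exact: add_continuous.
by apply: cvgMl; exact: parseval.
Unshelve. all: by end_near.
Qed.

Section OrthonormalFamilies.
Context (I J : finType) (p : I -> H) (q : J -> H).
Hypothesis p_on : forall i j, dot (p i) (p j) = (i == j)%:R.
Hypothesis q_on : forall i j, dot (q i) (q j) = (i == j)%:R.

Lemma hs_norm_sqr_orthonormal (y : I -> H) (e : nat -> H) (B : H -> H) :
  orthonormal_basis dot e -> (forall v, B v = \sum_i dot v (p i) *: y i) ->
  (hs_norm e B ^+ 2)%E = (\sum_i dot (y i) (y i))%:E.
Proof.
move=> he /(hs_norm_sqr he) ->; congr EFin; apply: eq_bigr => i _.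
rewrite -[RHS](dot_delta_sum (fun j => dot (y i) (y j))).
by apply: eq_bigr => j _; rewrite p_on.
Qed.

(** The difference is one finite-rank operator indexed by the disjoint union of I and J, with the
    sign carried by the [z j]. *)
Lemma hs_norm_sqr_sub (y : I -> H) (z : J -> H) (e : nat -> H) (B : H -> H) :
  orthonormal_basis dot e ->
  (forall v, B v = \sum_i dot v (p i) *: y i - \sum_j dot v (q j) *: z j) ->
  (hs_norm e B ^+ 2)%E =
  (\sum_i dot (y i) (y i) + \sum_j dot (z j) (z j)
   - 2 * \sum_j \sum_i dot (q j) (p i) * dot (z j) (y i))%:E.
Proof.
move=> he BE.
pose x' s := match s with inl i => p i | inr j => q j end.
pose y' s := match s with inl i => y i | inr j => -1 *: z j end.
rewrite (hs_norm_sqr (x := x') (y := y') he) => [|v]; last first.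
  rewrite BE big_sumType /= -sumrN; congr (_ + _); apply: eq_bigr => j _.
  by rewrite scaleN1r scalerN.
congr EFin; rewrite big_sumType /=.
under eq_bigr do rewrite big_sumType /=.
under [X in _ + X = _]eq_bigr do rewrite big_sumType /=.
rewrite !big_split /=.
have -> : \sum_i \sum_j dot (p i) (p j) * dot (y i) (y j) =
          \sum_i dot (y i) (y i).
  apply: eq_bigr => i _; rewrite -[RHS](dot_delta_sum (fun j => dot (y i) (y j))).
  by apply: eq_bigr => j _; rewrite p_on.
have -> : \sum_i \sum_j dot (q i) (q j) * dot (-1 *: z i) (-1 *: z j) =
          \sum_i dot (z i) (z i).
  apply: eq_bigr => i _; rewrite -[RHS](dot_delta_sum (fun j => dot (z i) (z j))).
  by apply: eq_bigr => j _; rewrite q_on dotZl dotZr !mulN1r opprK.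
have cross : \sum_j \sum_i dot (q j) (p i) * dot (-1 *: z j) (y i) =
    - \sum_j \sum_i dot (q j) (p i) * dot (z j) (y i).
  rewrite -sumrN; apply: eq_bigr => j _; rewrite -sumrN; apply: eq_bigr => i _.
  by rewrite dotZl mulN1r mulrN.
have -> : \sum_i \sum_j dot (p i) (q j) * dot (y i) (-1 *: z j) =
          \sum_j \sum_i dot (q j) (p i) * dot (-1 *: z j) (y i).
  rewrite exchange_big; apply: eq_bigr => j _; apply: eq_bigr => i _.
  by congr (_ * _); exact: dotC.
by rewrite cross; ring.
Qed.

End OrthonormalFamilies.

End HilbertBasis.

(** This is where the constant c_h comes from. With t = nu / l the left side is (t - 1)^2 l, and 0 <
    t <= nM / l1: for t <= 1 the square is at most 1, for t > 1 it is at most (nM / l1 - 1)^2. *)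
Lemma sqr_ratio_sub1_le (R : realFieldType) (l l1 nu nM : R) :
  0 < l1 -> l1 <= l -> 0 < nu -> nu <= nM ->
  (l - nu) ^+ 2 / l <= Num.max ((nM / l1 - 1) ^+ 2) 1 * l.
Proof.
move=> l1_gt0 l1l nu0 nuM.
have l0 : 0 < l by exact: lt_le_trans l1l.
have -> : (l - nu) ^+ 2 / l = (nu / l - 1) ^+ 2 * l.
  by field; rewrite gt_eqF.
apply: ler_wpM2r; first exact: ltW.
have t0 : 0 < nu / l by rewrite divr_gt0.
have tM : nu / l <= nM / l1.
  by rewrite ler_pM// ?invr_ge0 ?(ltW l0) ?(ltW nu0)// lef_pV2 ?posrE.
rewrite le_max; apply/orP; have [t1|t1] := leP (nu / l) 1; [right|left]; nra.
Qed.

(** * The operators A^(1/2) and A^(-1/2) *)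

Section Galerkin.
Context (R : realType) (H : completeNormedModType R) (dot : {dot H for idfun}).
Hypothesis dot_norm : forall x : H, dot x x = `|x| ^+ 2.
Context (lam : nat -> R) (phi : nat -> H).
Hypothesis phi_basis : orthonormal_basis dot phi.
Hypothesis lam_gt0 : forall k, (0 < k)%N -> 0 < lam k.
Hypothesis lam_le : forall j k, (1 <= j <= k)%N -> lam j <= lam k.

Lemma coord_sqrt v k : pow_dom dot lam phi 2^-1 v -> (0 < k)%N ->
  dot (pow_op dot lam phi 2^-1 v) (phi k) = Num.sqrt (lam k) * dot v (phi k).
Proof.
by move=> dv k0; rewrite coord_pow_op// powR12_sqrt// ltW// lam_gt0.
Qed.

(** As the eigenvalues are at least lam_1, Bessel bounds the defining series by |v|^2 / lam_1. *)
Lemma pow_dom_invsqrt v : pow_dom dot lam phi (- 2^-1) v.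
Proof.
rewrite /pow_dom /=; apply: (@le_lt_trans _ _ ((lam 1%N)^-1 * dot v v)%:E);
  last exact: ltry.
apply: lime_le.
  by apply: is_cvg_nneseries => n _ _; rewrite lee_fin mulr_ge0 ?powR_ge0 ?sqr_ge0.
near=> n; rewrite sumEFin lee_fin.
apply: le_trans (ler_wpM2l _ (bessel_seq dot_norm v n phi_basis)); last first.
  by rewrite invr_ge0 ltW// lam_gt0.
rewrite mulr_sumr; apply: ler_sum_nat => k /andP[k0 _].
rewrite real_normK ?num_real// mulrN divff// powR_inv1 ?(ltW (lam_gt0 k0))//.
apply: ler_wpM2r; first exact: sqr_ge0.
by rewrite lef_pV2 ?posrE ?lam_gt0// lam_le.
Unshelve. all: by end_near.
Qed.

Lemma coord_invsqrt v k : (0 < k)%N ->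
  dot (pow_op dot lam phi (- 2^-1) v) (phi k) =
  (Num.sqrt (lam k))^-1 * dot v (phi k).
Proof.
move=> k0; rewrite coord_pow_op//; last exact: pow_dom_invsqrt.
by rewrite powRN powR12_sqrt// ltW// lam_gt0.
Qed.

Lemma pow_op_lincomb s (I : finType) (a : I -> R) (x y : I -> H) :
  (forall i k, (0 < k)%N -> dot (y i) (phi k) = lam k `^ s * dot (x i) (phi k)) ->
  pow_op dot lam phi s (\sum_i a i *: x i) = \sum_i a i *: y i.
Proof.
move=> xy; apply: pow_op_eq => // k k0.
rewrite !dot_suml mulr_sumr; apply: eq_bigr => i _.
by rewrite !dotZl xy// mulrCA.
Qed.

(** * Residual and errors of the cluster m, ..., M *)

Section Cluster.
Context (m M N : nat) (V : set H) (lamh : nat -> R) (phih : nat -> H).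
Hypothesis hm : (1 <= m)%N.
Hypothesis hMN : (M <= N)%N.
Hypothesis hV_dom : V `<=` pow_dom dot lam phi 2^-1.
Hypothesis hh : approx_eigensystem dot lam phi V N lamh phih.

(** The cluster is reindexed from 0 by a shift of [m], so that all its matrices are indexed by one
    finite type. *)
Local Notation I := 'I_(M.+1 - m).
Local Notation Ahalf := (pow_op dot lam phi 2^-1).
Let p (i : I) := phi (i + m).
Let q (i : I) := phih (i + m).
Let mu (i : I) := lam (i + m).
Let nu (i : I) := lamh (i + m).
Let r (i : I) := Ahalf (q i) - nu i *: pow_op dot lam phi (- 2^-1) (q i).

Lemma idx_gt0 (i : I) : (0 < i + m)%N.
Proof. by rewrite addn_gt0 hm orbT. Qed.

Lemma idx_le (i : I) : (i + m <= M)%N.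
Proof. by have := ltn_ord i; rewrite ltn_subRL addnC ltnS. Qed.

Lemma idx_rng (i : I) : (1 <= i + m <= N)%N.
Proof. by rewrite idx_gt0 (leq_trans (idx_le i)). Qed.

Lemma density_matrixE f v :
  density_matrix dot m M f v = \sum_(i < M.+1 - m) dot v (f (i + m)%N) *: f (i + m)%N.
Proof. by rewrite /density_matrix -{1}(add0n m) big_addn big_mkord. Qed.

Lemma p_orthonormal i j : dot (p i) (p j) = (i == j)%:R.
Proof.
by rewrite /p (orthonormal_eq phi_basis.1) ?idx_gt0// eqn_add2r.
Qed.

Lemma q_orthonormal i j : dot (q i) (q j) = (i == j)%:R.
Proof.
by rewrite /q (approx_orthonormal hh (idx_rng i) (idx_rng j)) eqn_add2r.
Qed.

Lemma q_dom i : pow_dom dot lam phi 2^-1 (q i).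
Proof. by apply: hV_dom; exact: (approx_in hh (idx_rng i)). Qed.

Lemma dot_Ahalf_q i j : dot (Ahalf (q i)) (Ahalf (q j)) = nu i * (i == j)%:R.
Proof.
have qjV : V (q j) by exact: (approx_in hh (idx_rng j)).
by rewrite -q_orthonormal; exact: (approx_eq hh (idx_rng i) qjV).
Qed.

Lemma coord_Ahalf_q i k : (0 < k)%N ->
  dot (Ahalf (q i)) (phi k) = Num.sqrt (lam k) * dot (q i) (phi k).
Proof. by move=> k0; apply: coord_sqrt => //; exact: q_dom. Qed.

Lemma coord_r i k : (0 < k)%N ->
  dot (r i) (phi k) ^+ 2 = (lam k - nu i) ^+ 2 / lam k * dot (q i) (phi k) ^+ 2.
Proof.
move=> k0; rewrite /r dotBl dotZl coord_Ahalf_q// coord_invsqrt//.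
have l0 := lam_gt0 k0; have s0 : Num.sqrt (lam k) != 0 by rewrite sqrtr_eq0 -ltNge.
have lE : lam k = Num.sqrt (lam k) ^+ 2 by rewrite sqr_sqrtr ?ltW.
move: lE s0; move: (Num.sqrt _) => s -> s0; by field.
Qed.

Lemma Ahalf_gammah v :
  Ahalf (density_matrix dot m M phih v) = \sum_i dot v (q i) *: Ahalf (q i).
Proof.
rewrite density_matrixE; apply: pow_op_lincomb => i k k0.
by rewrite coord_pow_op//; exact: q_dom.
Qed.

Lemma residualE v :
  residual dot lam phi (density_matrix dot m M phih) v = \sum_i dot v (q i) *: r i.
Proof.
rewrite /residual /=.
set B := Ahalf \o _.
have BE u : B u = \sum_i dot u (q i) *: Ahalf (q i) by exact: Ahalf_gammah.
have -> : adjoint dot B (B v) = \sum_i dot (Ahalf (q i)) (B v) *: q i.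
  apply: adjoint_eq => u; rewrite BE dot_suml dot_sumr; apply: eq_bigr => i _.
  by rewrite dotZl dotZr mulrC.
rewrite (@pow_op_lincomb _ _ _ _
  (fun i => pow_op dot lam phi (- 2^-1) (q i))); last first.
  by move=> i k k0; rewrite coord_pow_op//; exact: pow_dom_invsqrt.
rewrite -[Ahalf _]/(B v) {1}BE -sumrB; apply: eq_bigr => i _.
rewrite scalerBr scalerA; congr (_ - _ *: _).
(* The vectors A^(1/2) q_j are orthogonal with square norms nu_j, so (A^(1/2) q_i, B v) reduces to
   nu_i (v, q_i). *)
rewrite BE dot_sumr -(dot_delta_sum (fun j => dot v (q j) * nu j) i).
apply: eq_bigr => j _; rewrite dotZr dot_Ahalf_q.
by case: eqVneq => [->|_]; rewrite ?mulr1 ?mul1r ?mul0r ?mulr0.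
Qed.

(** Pythagoras splits |r_i|^2. The cluster coordinates are kept as they are; the others are compared
    with those of A^(1/2) q_i, whose squares are lam_k (q_i, phi_k)^2. *)
Lemma residual_in_out i :
  dot (r i) (r i) <=
  Num.max ((lamh M / lam 1%N - 1) ^+ 2) 1 *
    (nu i - \sum_k mu k * dot (q i) (p k) ^+ 2) +
  \sum_k (mu k - nu i) ^+ 2 / mu k * dot (q i) (p k) ^+ 2.
Proof.
have -> : nu i - \sum_k mu k * dot (q i) (p k) ^+ 2 =
    dot (Ahalf (q i) - proj_onto dot p (Ahalf (q i)))
        (Ahalf (q i) - proj_onto dot p (Ahalf (q i))).
  rewrite (dot_sub_proj p_orthonormal) dot_Ahalf_q eqxx mulr1; congr (_ - _).
  apply: eq_bigr => k _; rewrite coord_Ahalf_q ?idx_gt0//.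
  by rewrite mulrACA -!expr2 sqr_sqrtr// ltW// lam_gt0 ?idx_gt0.
have -> : \sum_k (mu k - nu i) ^+ 2 / mu k * dot (q i) (p k) ^+ 2 =
    \sum_k dot (r i) (p k) * dot (r i) (p k).
  by apply: eq_bigr => k _; rewrite -expr2 coord_r// idx_gt0.
(* Both sides now involve only components orthogonal to the cluster: their coordinates vanish inside
   it, and outside it the projection changes nothing. *)
rewrite -lerBlDr -(dot_sub_proj p_orthonormal).
apply: (parseval_le dot_norm phi_basis) => k k0.
have [/andP[mk kM]|kout] := boolP (m <= k <= M)%N.
  have kn : (k - m < M.+1 - m)%N by rewrite ltn_sub2rE.
  have -> : phi k = p (Ordinal kn) by rewrite /p /= subnK.
  have perp u : dot (u - proj_onto dot p u) (p (Ordinal kn)) = 0.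
    by rewrite dotBl (dot_proj p_orthonormal) subrr.
  by rewrite !perp expr2 mul0r mulr0.
have perp u : dot (u - proj_onto dot p u) (phi k) = dot u (phi k).
  rewrite dotBl dot_suml big1 ?subr0// => j _.
  rewrite dotZl (orthonormal_eq phi_basis.1) ?idx_gt0//.
  case: eqVneq => [jk|]; last by rewrite mulr0.
  by rewrite -jk leq_addl idx_le in kout.
rewrite !perp coord_r// coord_Ahalf_q// exprMn.
rewrite sqr_sqrtr ?(ltW (lam_gt0 k0))// [leRHS]mulrA.
apply: ler_wpM2r; first exact: sqr_ge0.
apply: sqr_ratio_sub1_le => //; first exact: lam_gt0.
- by apply: lam_le; rewrite k0.
- exact: (approx_gt0 hh (idx_rng i)).
- by apply: (approx_le hh); rewrite ?idx_gt0// idx_le.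
Qed.

(** Each projector contributes the cardinality of the cluster, and the cross term is twice the sum
    of the squared entries of G; what remains is 2 D. *)
Lemma hs_err e : orthonormal_basis dot e ->
  (hs_norm e (density_matrix dot m M phi \- density_matrix dot m M phih)%R ^+ 2)%E =
  (2 * \sum_k (1 - \sum_i dot (q i) (p k) ^+ 2))%:E.
Proof.
move=> he; rewrite (hs_norm_sqr_sub dot_norm p_orthonormal q_orthonormal
  (y := p) (z := q) he) => [|v]; last by rewrite /= !density_matrixE.
have unit_trace (f : I -> H) : (forall i j, dot (f i) (f j) = (i == j)%:R) ->
    \sum_i dot (f i) (f i) = \sum_(i : I) 1.
  by move=> f_on; apply: eq_bigr => i _; rewrite f_on eqxx.
congr EFin; rewrite (unit_trace p p_orthonormal) (unit_trace q q_orthonormal).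
have -> : \sum_j \sum_i dot (q j) (p i) * dot (q j) (p i) =
    \sum_k \sum_i dot (q i) (p k) ^+ 2.
  by rewrite exchange_big.
by rewrite sumrB; ring.
Qed.

(** The expansion is tr Lam plus the sum of the nu_i minus twice the sum of the mu_k G_ik^2. One
    copy of the last sum completes the nu_i to T, the other completes tr Lam to tr (Lam Delta). *)
Lemma hs_errA e : orthonormal_basis dot e ->
  (hs_norm e (Ahalf \o
    (density_matrix dot m M phi \- density_matrix dot m M phih)%R) ^+ 2)%E =
  (\sum_i (nu i - \sum_k mu k * dot (q i) (p k) ^+ 2) +
   \sum_k mu k * (1 - \sum_i dot (q i) (p k) ^+ 2))%:E.
Proof.
move=> he.
have mu0 i : 0 < mu i by rewrite lam_gt0 ?idx_gt0.
rewrite (hs_norm_sqr_sub dot_norm p_orthonormal q_orthonormal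
  (y := fun i => Num.sqrt (mu i) *: p i) (z := fun i => Ahalf (q i)) he); last first.
  move=> v; rewrite /=; apply: pow_op_eq => // k k0.
  rewrite !density_matrixE !dotBl mulrBr powR12_sqrt ?ltW ?lam_gt0//.
  rewrite !dot_suml !mulr_sumr; congr (_ - _); apply: eq_bigr => i _.
    rewrite !dotZl (orthonormal_eq phi_basis.1) ?idx_gt0//.
    by case: eqVneq => [<-|_]; rewrite ?mulr0// /mu; ring.
  by rewrite !dotZl coord_Ahalf_q// mulrCA.
congr EFin.
rewrite (eq_bigr mu) => [|i _]; last first.
  by rewrite dotZl dotZr p_orthonormal eqxx mulr1 -expr2 sqr_sqrtr// ltW.
rewrite [X in _ + X - _](eq_bigr nu) => [|i _]; last first.
  by rewrite dot_Ahalf_q eqxx mulr1.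
rewrite [X in _ - 2 * X](eq_bigr (fun j =>
    \sum_k mu k * dot (q j) (p k) ^+ 2)) => [|i _]; last first.
  apply: eq_bigr => k _; rewrite dotZr coord_Ahalf_q ?idx_gt0//.
  by rewrite -[in RHS](sqr_sqrtr (ltW (mu0 k))) /mu; ring.
have -> : \sum_k mu k * (1 - \sum_i dot (q i) (p k) ^+ 2) =
    \sum_k mu k - \sum_i \sum_k mu k * dot (q i) (p k) ^+ 2.
  rewrite exchange_big -sumrB; apply: eq_bigr => k _.
  by rewrite mulrBr mulr1 mulr_sumr.
by rewrite sumrB; ring.
Qed.

Lemma hs_residual e : orthonormal_basis dot e ->
  (hs_norm e (residual dot lam phi (density_matrix dot m M phih)%R) ^+ 2)%E =
  (\sum_i dot (r i) (r i))%:E.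
Proof.
move=> he; exact: (hs_norm_sqr_orthonormal dot_norm q_orthonormal he residualE).
Qed.

Lemma residual_le :
  \sum_i dot (r i) (r i) <=
  Num.max ((lamh M / lam 1%N - 1) ^+ 2) 1 *
    (\sum_i (nu i - \sum_k mu k * dot (q i) (p k) ^+ 2)) +
  2 / lam m * ((\sum_i (nu i - \sum_k mu k * dot (q i) (p k) ^+ 2)) ^+ 2 +
               lam M ^+ 2 * (\sum_k (1 - \sum_i dot (q i) (p k) ^+ 2)) ^+ 2).
Proof.
apply: le_trans (ler_sum _ (fun i _ => residual_in_out i)) _.
rewrite big_split /= -mulr_sumr lerD2l.
apply: cluster_bound.
- exact: p_orthonormal.
- exact: q_orthonormal.
- exact: dot_Ahalf_q.
- by move=> i k; rewrite coord_Ahalf_q ?idx_gt0.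
- exact: lam_gt0.
- by move=> k; rewrite !lam_le ?idx_gt0 ?idx_le// hm leq_addl.
Qed.

(** Bessel for [q] handles the diagonal of Delta; [stiffness_defect_ge0] does the same for Omega
    with [p]. *)
Lemma defect_ge0 k : 0 <= 1 - \sum_i dot (q i) (p k) ^+ 2.
Proof.
rewrite subr_ge0; apply: le_trans (_ : dot (p k) (p k) <= 1); last first.
  by rewrite p_orthonormal eqxx.
apply: le_trans (bessel q_orthonormal (p k)).
by apply: ler_sum => i _; rewrite dotC.
Qed.

Lemma stiffness_defect_ge0 i : 0 <= nu i - \sum_k mu k * dot (q i) (p k) ^+ 2.
Proof.
rewrite subr_ge0.
apply: le_trans (_ : dot (Ahalf (q i)) (Ahalf (q i)) <= _); last first.
  by rewrite dot_Ahalf_q eqxx mulr1.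
apply: le_trans (bessel p_orthonormal _); apply: ler_sum => k _.
by rewrite coord_Ahalf_q ?idx_gt0// exprMn sqr_sqrtr// ltW// lam_gt0 ?idx_gt0.
Qed.

End Cluster.

End Galerkin.

(** * Comparison of the constants and conclusion *)

Lemma residual_bound_real (R : realFieldType) (c lm lM T D D' : R) :
  0 < lm -> 0 <= c -> 0 <= T -> 0 <= D -> 0 <= D' -> 0 <= lM ->
  c * T + 2 / lm * (T ^+ 2 + lM ^+ 2 * D ^+ 2) <=
  c * (T + D') + 3 * (lM - lm) ^+ 2 / (4 * lm) * (2 * D) ^+ 2
  + 3 / lm * (1 + 1 / 4 * (2 * D) ^+ 2) *
    (2 * (1 + lM / (4 * lm) * (2 * D)) ^+ 2 * (T + D') ^+ 2
     + 2 * lM ^+ 2 * (2 * D) ^+ 2).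
Proof.
move=> lm0 c0 T0 D0 D'0 lM0.
(* The right side has slack: this summand is nonnegative, the factors 1 + x are at least 1, T <= T +
   D', and 2 <= 3. *)
have h1 : 0 <= 3 * (lM - lm) ^+ 2 / (4 * lm) * (2 * D) ^+ 2.
  by rewrite !(sqr_ge0, divr_ge0, mulr_ge0, ltW lm0).
have h2 : 0 <= lM / (4 * lm) * (2 * D).
  by rewrite mulr_ge0 ?divr_ge0 ?mulr_ge0 ?(ltW lm0).
have h3 : c * T <= c * (T + D') by rewrite ler_wpM2l// lerDl.
have h4 : T ^+ 2 <= (1 + lM / (4 * lm) * (2 * D)) ^+ 2 * (T + D') ^+ 2.
  move: h2; set x := _ * (2 * D) => x0.
  rewrite -exprMn ler_sqr ?nnegrE ?mulr_ge0 ?addr_ge0//.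
  rewrite mulrDl mul1r -addrA lerDl addr_ge0// mulr_ge0// addr_ge0//.
have h5 : 0 <= lM ^+ 2 * D ^+ 2 by rewrite mulr_ge0 ?sqr_ge0.
set P := 2 * _ ^+ 2 * _ + _.
have h6 : T ^+ 2 + lM ^+ 2 * D ^+ 2 <= P.
  have -> : P = 2 * ((1 + lM / (4 * lm) * (2 * D)) ^+ 2 * (T + D') ^+ 2) +
      8 * (lM ^+ 2 * D ^+ 2) by rewrite /P; ring.
  by have := sqr_ge0 T; lra.
have h7 : P <= (1 + 1 / 4 * (2 * D) ^+ 2) * P.
  have P0 : 0 <= P by apply: le_trans h6; rewrite addr_ge0 ?sqr_ge0.
  by rewrite ler_peMl// lerDl mulr_ge0 ?sqr_ge0.
have h8 : 2 / lm * (T ^+ 2 + lM ^+ 2 * D ^+ 2) <=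
          3 / lm * ((1 + 1 / 4 * (2 * D) ^+ 2) * P).
  apply: ler_pM.
  - by rewrite divr_ge0// ltW.
  - by rewrite addr_ge0 ?sqr_ge0.
  - by rewrite ler_pM2r ?invr_gt0// ler_nat.
  - exact: le_trans h6 h7.
by rewrite -[3 / lm * _ * P]mulrA; lra.
Qed.

Theorem theorem4p6 (R : realType) (H : completeNormedModType R)
  (dot : {dot H for idfun}) (A : unbounded_op H)
  (lam : nat -> R) (phi : nat -> H)
  (m M N : nat) (V : set H) (lamh : nat -> R) (phih : nat -> H)
  (e : nat -> H)
  (hH : separable_hilbert dot)
  (hA_sa : self_adjoint dot A)
  (hA_pos : positive_definite dot A)
  (hA_cpt : compact_resolvent A)
  (hA_eig : eigensystem dot A lam phi)
  (hm : (1 <= m)%N) (hmM : (m <= M)%N)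
  (hV : subspace_of_dim V N)
  (hV_dom : V `<=` pow_dom dot lam phi 2^-1)
  (hMN : (M <= N)%N)
  (hh : approx_eigensystem dot lam phi V N lamh phih)
  (* an arbitrary orthonormal basis, used to compute Hilbert-Schmidt norms *)
  (he : orthonormal_basis dot e)
  (hgap_m : (1 < m)%N -> lam m.-1 < lam m)
  (hgap_M : lam M < lam M.+1)
  (hnondeg : forall v, lin_span m M phi v -> v != 0 ->
     `|density_matrix dot m M phih v| != 0) :
  let gamma0 := density_matrix dot m M phi in
  let gammah := density_matrix dot m M phih in
  let Ahalf := pow_op dot lam phi 2^-1 in
  let ch : R := Num.max ((lamh M / lam 1%N - 1) ^+ 2) 1 in
  let err := hs_norm e (gamma0 \- gammah) in
  let errA := hs_norm e (Ahalf \o (gamma0 \- gammah)) in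
  (hs_norm e (residual dot lam phi gammah) ^+ 2 <=
     ch%:E * errA ^+ 2
     + (3 * (lam M - lam m) ^+ 2 / (4 * lam m))%:E * err ^+ 4
     + (3 / lam m)%:E * (1 + (1 / 4)%:E * err ^+ 4)
       * (2%:E * (1 + (lam M / (4 * lam m))%:E * err ^+ 2) ^+ 2 * errA ^+ 4
          + (2 * lam M ^+ 2)%:E * err ^+ 4))%E.
Proof.
cbv zeta; have [dot_norm _] := hH.
case: hA_eig => phi_basis _ lam_gt0 lam_le _.
(* The squared norms are known as finite reals, so writing fourth powers as squares of squares
   brings the inequality down to R. *)
have pow4 (x : \bar R) : (x ^+ 4 = (x ^+ 2) ^+ 2)%E.
  by rewrite !expeS !expe0 !mule1 !muleA.
rewrite !pow4 (hs_err dot_norm phi_basis hm hMN hh he).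
rewrite (hs_errA dot_norm phi_basis lam_gt0 hm hMN hV_dom hh he).
rewrite (hs_residual dot_norm phi_basis lam_gt0 lam_le hm hMN hV_dom hh he).
have := residual_le dot_norm phi_basis lam_gt0 lam_le hm hMN hV_dom hh.
move=> res_le; rewrite -?EFinM -?EFinD -?EFinM -?EFinD lee_fin.
apply: le_trans res_le _.
have def_ge0 := defect_ge0 phi_basis hm hMN hh.
(* Here D' = tr (Lam Delta), so that the squared errors are 2 D and T + D'. *)
apply: residual_bound_real.
- exact: lam_gt0.
- by rewrite le_max ler01 orbT.
- apply: sumr_ge0 => i _.
  exact: (stiffness_defect_ge0 dot_norm phi_basis lam_gt0 hm hMN hV_dom hh).
- by apply: sumr_ge0 => k _; exact: def_ge0.
- apply: sumr_ge0 => k _; apply: mulr_ge0; last exact: def_ge0.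
  by rewrite ltW// lam_gt0// addn_gt0 hm orbT.
- by rewrite ltW// lam_gt0// (leq_trans hm).
Qed.
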